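(* A finite group $G$ has exactly $|G|-2$ cyclic subgroups if and only if $G$ is isomorphic to one of the following groups: $C_4\times C_2$, $D_8\times C_2$, $C_6$, or $D_{12}$.
   Context: $C_n$ denotes the cyclic group of order $n$, and $D_{2n}$ denotes the dihedral group of order $2n$. The trivial subgroup counts as a cyclic subgroup. *)

(* Defs.v *)
From HB Require Import structures.
From mathcomp Require Import all_boot all_order all_fingroup all_algebra all_solvable.

Set Implicit Arguments.
Unset Strict Implicit.
Unset Printing Implicit Defensive.

Local Open Scope group_scope.

Definition cyclic_subgroups (gT : finGroupType) (G : {group gT}) :
  {set {group gT}} := [set H in subgroups G | cyclic H].

(* Main.v *)
(* The map [g |-> <[g]>] from [G] onto its cyclic subgroups identifies [g] with [g^-1]
   and is injective on elements with [g ^+ 2 = 1]; so it loses exactly two elements iff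
   the elements of order > 2 are [x, x^-1, y, y^-1] with [<[x]> != <[y]>].  Then either
   they all lie in a cyclic subgroup [A] of order 6, or [x] and [y] commute, have order 4
   and the same square, and [A = <[x]> \x <[x * y]>] has type [C_4 x C_2].  All elements
   outside [A] are involutions, hence invert [A], and two of them have their product
   in [A]; so [G] is [A] or the generalised dihedral group of [A]. *)
Require Import Defs.
From HB Require Import structures.
From mathcomp Require Import all_boot all_order all_fingroup all_algebra all_solvable.

Set Implicit Arguments.
Unset Strict Implicit.
Unset Printing Implicit Defensive.

Local Open Scope group_scope.

(** * Counting cyclic subgroups through the elements of order greater than 2 *)

Section Counting.

Variables (gT : finGroupType) (G : {group gT}).
Implicit Types (x y z g h t : gT) (E : {set gT}).

Lemma sqrg_neq1 x : (x ^+ 2 != 1) = (x != x^-1).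
Proof. by rewrite expgS expg1 -eq_invg_mul eq_sym. Qed.

Lemma mem_cycle_involution x g : x ^+ 2 = 1 -> (g \in <[x]>) = (g \in [:: 1; x]).
Proof.
move=> x2; apply/idP/idP; last first.
  by rewrite !inE => /orP[]/eqP->; rewrite ?group1 ?cycle_id.
case/cycleP=> i ->; rewrite (divn_eq i 2) expgD mulnC expgM x2 expg1n mul1g.
by rewrite modn2; case: (odd i); rewrite !inE eqxx ?orbT.
Qed.

Lemma cycle_eq_involution x y : x ^+ 2 = 1 -> <[x]> = <[y]> -> x = y.
Proof.
move=> x2 eqxy; have: y \in <[x]> by rewrite eqxy cycle_id.
rewrite mem_cycle_involution // !inE => /orP[]/eqP // y1.
by apply/eqP; rewrite y1 -cycle_eq1 eqxy y1 cycle1.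
Qed.

Lemma cyclic_subgroupsE : cyclic_subgroups G = [set <[g]>%G | g in G].
Proof.
apply/setP=> H; rewrite !inE; apply/andP/imsetP=> [[sHG /cyclicP[g defH]]|[g Gg ->]].
  exists g; last exact: group_inj.
  by rewrite (subsetP sHG) // defH cycle_id.
by rewrite /= cycle_subG cycle_cyclic.
Qed.

(** [E] collects redundant generators: [g |-> <[g]>] restricted to [G :\: E] still reaches every
    cyclic subgroup. *)
Lemma card_cyclic_subgroups_le E :
    E \subset G -> {in E, forall g, exists2 h, h \in G :\: E & <[g]> = <[h]>} ->
  #|cyclic_subgroups G| + #|E| <= #|G|.
Proof.
move=> sEG repE; rewrite -(cardsID E G) (setIidPr sEG) addnC leq_add2l.
rewrite cyclic_subgroupsE; apply: leq_trans (leq_imset_card (fun g => <[g]>%G) _).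
apply/subset_leq_card/subsetP=> _ /imsetP[g Gg ->].
have [/repE[h Dh eq_gh] | E'g] := boolP (g \in E); last by rewrite imset_f // inE E'g.
by apply/imsetP; exists h => //; apply: group_inj.
Qed.

(** The map [g |-> <[g]>] is injective on [G :\: E]. Only pairs with nontrivial squares need a
    hypothesis, since [cycle_eq_involution] settles the others. *)
Lemma card_cyclic_subgroups_ge E :
    {in G :\: E &, forall g h, g ^+ 2 != 1 -> h ^+ 2 != 1 -> <[g]> = <[h]> -> g = h} ->
  #|G| <= #|cyclic_subgroups G| + #|E|.
Proof.
move=> injD; rewrite -(cardsID E G) addnC leq_add ?subset_leq_card ?subsetIr //.
rewrite cyclic_subgroupsE -(card_in_imset (f := fun g => <[g]>%G) (D := mem (G :\: E))).
  by apply/subset_leq_card/imsetS/subsetDl.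
move=> g h Dg Dh /(congr1 val)/= eq_gh.
have [g2|g2] := eqVneq (g ^+ 2) 1; first exact: cycle_eq_involution.
have [h2|h2] := eqVneq (h ^+ 2) 1; first exact/esym/cycle_eq_involution.
exact: injD.
Qed.

(** Distinct cycles and nontrivial squares make the four listed elements pairwise distinct, so they
    are exactly the elements of order greater than 2. *)
Definition two_pairs x y :=
  [/\ x \in G, y \in G, x ^+ 2 != 1 /\ y ^+ 2 != 1, <[x]> != <[y]>
    & {in G, forall g, g ^+ 2 != 1 -> g \in [:: x; x^-1; y; y^-1]}].

(** Both bounds are applied to the same set, one element from each inverse pair: [x^-1] and
    [y^-1]. *)
Lemma cycle_card_two_pairs x y :
  two_pairs x y -> (#|cyclic_subgroups G| + 2)%N = #|G|.
Proof.
case=> Gx Gy [x2 y2] neq_xy memT.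
have [x'V y'V] : x != x^-1 /\ y != y^-1 by rewrite -!sqrg_neq1.
have neqVxy: x^-1 != y^-1.
  by apply: contraNneq neq_xy => /invg_inj->.
have neqVx: x^-1 != y by apply: contraNneq neq_xy => <-; rewrite cycleV.
have neqx: x != y by apply: contraNneq neq_xy => <-.
have neqxV: x != y^-1 by apply: contraNneq neq_xy => ->; rewrite cycleV.
have cardE: #|[set x^-1; y^-1]| = 2 by rewrite cards2 neqVxy.
apply/eqP; rewrite eqn_leq -{1}cardE card_cyclic_subgroups_le /=.
- rewrite -cardE card_cyclic_subgroups_ge // => g h; rewrite !inE !negb_or.
  case/andP=> /andP[gx gy] Gg /andP[/andP[hx hy] Gh] g2 h2 eq_gh.
  have:= memT g Gg g2; have:= memT h Gh h2.
  rewrite !inE (negPf gx) (negPf gy) (negPf hx) (negPf hy) /= !orbF.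
  by case/orP=> /eqP eh /orP[]/eqP eg;
    move: eq_gh; rewrite eh eg // => eq_xy; rewrite eq_xy eqxx in neq_xy.
- by apply/subsetP=> g; rewrite !inE => /orP[]/eqP->; rewrite groupV.
- move=> g; rewrite !inE => /orP[]/eqP->; [exists x | exists y]; rewrite ?cycleV //.
    by rewrite !inE Gx negb_or x'V neqxV.
  by rewrite !inE Gy negb_or y'V eq_sym neqVx.
Qed.

(** Any other configuration yields either a set of at most one element off which the map is
    injective, or a set of three redundant generators; each contradicts the count. *)
Lemma two_pairs_of_card :
  (#|cyclic_subgroups G| + 2)%N = #|G| -> exists x y, two_pairs x y.
Proof.
move=> cardG.
have notle E : #|E| < 2 -> #|G| <= #|cyclic_subgroups G| + #|E| -> False.
  by move=> ltE; rewrite -cardG leq_add2l leqNgt ltE.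
have notge E : 2 < #|E| -> #|cyclic_subgroups G| + #|E| <= #|G| -> False.
  by move=> gtE; rewrite -cardG leq_add2l leqNgt gtE.
have [/existsP[x /andP[Gx x2]]|/existsPn G1] :=
  boolP [exists x, (x \in G) && (x ^+ 2 != 1)]; last first.
  case: (notle set0); first by rewrite cards0.
  apply: card_cyclic_subgroups_ge => g h; rewrite !inE /= => Gg _ g2.
  by case/negP: (G1 g); rewrite Gg g2.
have [/existsP[y]|/existsPn G1] :=
  boolP [exists y, [&& y \in G, y ^+ 2 != 1 & y \notin [:: x; x^-1]]]; last first.
  (* With a single inverse pair, dropping [x^-1] leaves [x] as the only element of order greater
     than 2. *)
  case: (notle [set x^-1]); first by rewrite cards1.
  have eqx g : g \in G :\ x^-1 -> g ^+ 2 != 1 -> g = x.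
    rewrite !inE => /andP[gx Gg] g2; apply/eqP; have:= G1 g.
    by rewrite Gg g2 !inE (negPf gx) orbF negbK.
  apply: card_cyclic_subgroups_ge => g h Dg Dh g2 h2 _.
  by rewrite (eqx g Dg g2) (eqx h Dh h2).
rewrite !inE negb_or => /and4P[Gy y2 yx yVx].
have [x'V y'V] : x != x^-1 /\ y != y^-1 by rewrite -!sqrg_neq1.
have xyV : x != y^-1 by rewrite -eqg_invLR eq_sym.
have card3 (a b c : gT) : a != b -> a != c -> b != c -> 2 < #|[set a; b; c]|.
  by move=> ab ac bc; rewrite setUC cardsU1 cards2 !inE ab negb_or ![c == _]eq_sym ac bc.
exists x, y; split=> //.
  (* If the cycles agreed, [x] alone would generate the cycle of each of the other three. *)
  apply/eqP=> eq_xy; apply: (notge [set x^-1; y; y^-1]).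
    by apply: card3 => //; rewrite ?eqg_inv eq_sym.
  apply: card_cyclic_subgroups_le.
    by apply/subsetP=> g; rewrite !inE -orbA => /or3P[]/eqP->; rewrite ?groupV.
  move=> g Eg; exists x; first by rewrite !inE !negb_or x'V xyV eq_sym yx.
  by move: Eg; rewrite !inE -orbA => /or3P[]/eqP->; rewrite ?cycleV.
move=> z Gz z2; apply/negPn/negP; rewrite !inE !negb_or => /and4P[zx zVx zy zVy].
have z'V: z != z^-1 by rewrite -sqrg_neq1.
have xzV : x != z^-1 by rewrite -eqg_invLR eq_sym.
have yzV : y != z^-1 by rewrite -eqg_invLR eq_sym.
(* A third inverse pair would make three inverses redundant. *)
apply: (notge [set x^-1; y^-1; z^-1]).
  by apply: card3; rewrite eqg_inv eq_sym.
apply: card_cyclic_subgroups_le.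
  by apply/subsetP=> g; rewrite !inE -orbA => /or3P[]/eqP->; rewrite groupV.
move=> g; rewrite !inE -orbA => /or3P[]/eqP->; rewrite cycleV;
  [exists x|exists y|exists z] => //.
- by rewrite !inE !negb_or x'V xyV xzV.
- by rewrite !inE !negb_or yVx y'V yzV.
- by rewrite !inE !negb_or zVx zVy z'V.
Qed.

End Counting.

Lemma cycle_expg_lt (gT : finGroupType) (x y : gT) n :
  0 < n -> x ^+ n = 1 -> y \in <[x]> -> exists2 i, i < n & y = x ^+ i.
Proof.
move=> n_gt0 xn /cycleP[i ->]; exists (i %% n); first by rewrite ltn_mod.
by rewrite expg_mod.
Qed.

(** * Structure forced by having exactly two inverse pairs *)

Section TwoPairs.

Variables (gT : finGroupType) (G : {group gT}).
Implicit Types x y z g : gT.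

Lemma two_pairs_sym x y : two_pairs G x y -> two_pairs G y x.
Proof.
case=> Gx Gy [x2 y2] neq_xy memT; split=> //; first by rewrite eq_sym.
by move=> g Gg /memT-/(_ Gg); rewrite !inE => /or4P[]->; rewrite ?orbT.
Qed.

(** Powers of [x] below the sixth are nontrivial, and [x ^+ 2] must be [y] or [y^-1]. Then [x ^+ 3]
    would be a fifth element of order greater than 2 unless [x ^+ 6 = 1]. *)
Lemma two_pairs_cycle_order6 x y : two_pairs G x y -> y \in <[x]> ->
  #[x] = 6 /\ {in G :\: <[x]>, forall g, g ^+ 2 = 1}.
Proof.
case=> Gx Gy [x2 y2] neq_xy memT Xy; split; last first.
  move=> g /setDP[Gg X'g]; apply: contraNeq X'g => /(memT g Gg).
  by rewrite !inE => /or4P[]/eqP->; rewrite ?groupV ?cycle_id.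
have x3 : x ^+ 3 != 1.
  apply/eqP=> x3; have [//|[|[|[|//]]] _ dy] := cycle_expg_lt _ x3 Xy.
  - by rewrite dy expg1n eqxx in y2.
  - by rewrite dy eqxx in neq_xy.
  - case/eqP: neq_xy; rewrite dy -(cycleV (x ^+ 2)); congr <[_]>.
    by apply: (mulIg (x ^+ 2)); rewrite mulVg -expgS.
have x4 : x ^+ 4 != 1.
  apply/eqP=> x4; have [//|[|[|[|[|//]]]] _ dy] := cycle_expg_lt _ x4 Xy.
  - by rewrite dy expg1n eqxx in y2.
  - by rewrite dy eqxx in neq_xy.
  - by rewrite dy -expgM x4 eqxx in y2.
  - case/eqP: neq_xy; rewrite dy -(cycleV (x ^+ 3)); congr <[_]>.
    by apply: (mulIg (x ^+ 3)); rewrite mulVg -expgS.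
have eqX i j : (x ^+ (i + j) == x ^+ j) = (x ^+ i == 1).
  by rewrite expgD -{2}(mul1g (x ^+ j)); apply: (inj_eq (mulIg _)).
have eqXV i j : (x ^+ i == (x ^+ j)^-1) = (x ^+ (i + j) == 1).
  by rewrite expgD -(mulVg (x ^+ j)); apply/esym/(inj_eq (mulIg _)).
have x1 : x ^+ 1 != 1 by apply: contraNneq x2 => x1; rewrite (expgM x 1%N 2%N) x1 expg1n.
have dy : y = x ^+ 2 \/ y = (x ^+ 2)^-1.
  have: x ^+ 2 \in [:: x; x^-1; y; y^-1] by apply: memT; rewrite ?groupX // -expgM.
  rewrite !inE (eqX 1%N 1%N) (eqXV 2%N 1%N) (negPf x1) (negPf x3) /=.
  by case/orP=> /eqP->; [left|right; rewrite invgK].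
have cyc_y : <[y]> = <[x ^+ 2]> by case: dy => ->; rewrite ?cycleV.
(* If [x ^+ 5 = 1], then [x] is the cube of [x ^+ 2], so [x] and [y] generate the same cycle. *)
have x5 : x ^+ 5 != 1.
  apply: contraNneq neq_xy => x5; rewrite eqEsubset !cycle_subG Xy andbT /= cyc_y.
  by apply/cycleP; exists 3; rewrite -expgM (expgD x 5%N 1%N) x5 mul1g.
have x6 : x ^+ 6 = 1.
  apply/eqP/negPn/negP=> x6.
  have: x ^+ 3 \in [:: x; x^-1; y; y^-1] by apply: memT; rewrite ?groupX // -expgM.
  have -> : x ^+ 3 \in [:: x; x^-1; y; y^-1]
          = (x ^+ 3 \in [:: x; x^-1; x ^+ 2; (x ^+ 2)^-1]).
    by case: dy => ->; rewrite !inE ?invgK // [X in [|| _, _ | X]]orbC.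
  rewrite !inE (eqX 2%N 1%N) (eqXV 3%N 1%N) (eqX 1%N 2%N) (eqXV 3%N 2%N).
  by rewrite (negPf x2) (negPf x4) (negPf x1) (negPf x5).
have: #[x] \in divisors 6 by rewrite -dvdn_divisors // order_dvdn x6.
rewrite !inE => /or4P[]/eqP // ox; last by rewrite -order_dvdn ox in x3.
  by rewrite -order_dvdn ox in x1.
by rewrite -order_dvdn ox in x2.
Qed.

(* If neither pair lies in the cycle of the other, then [y] normalises <[x]>; as
   [x * y] avoids all four elements of order > 2, it is an involution, which forces
   [x] and [y] to commute and to have the same square. *)
Lemma two_pairs_commute x y : two_pairs G x y -> y \notin <[x]> -> x \notin <[y]> ->
  [/\ commute x y, x ^+ 2 * y ^+ 2 = 1 & #[x] = 4].
Proof.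
case=> Gx Gy [x2 y2] neq_xy memT X'y Y'x.
have xy2 : (x * y) ^+ 2 = 1.
  apply/eqP/negPn/negP=> /(memT _ (groupM Gx Gy)); rewrite !inE => /or4P[]/eqP eq_xy.
  - by case/negP: X'y; rewrite -(groupMl _ (cycle_id x)) eq_xy cycle_id.
  - by case/negP: X'y; rewrite -(groupMl _ (cycle_id x)) eq_xy groupV cycle_id.
  - by case/negP: Y'x; rewrite -(groupMr _ (cycle_id y)) eq_xy cycle_id.
  - by case/negP: Y'x; rewrite -(groupMr _ (cycle_id y)) eq_xy groupV cycle_id.
have cxy : commute x y.
  have: x ^ y \in [:: x; x^-1; y; y^-1].
    by apply: memT; rewrite ?groupJ // -conjXg conjg_eq1.
  rewrite !inE => /or4P[]/eqP xJ.
  - by rewrite /commute conjgC xJ.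
  - by move: y2; rewrite -xy2 (expgS (x * y)) {1}(conjgC x y) xJ -mulgA mulKg eqxx.
  - by case/negP: Y'x; rewrite -(groupJr _ (cycle_id y)) xJ cycle_id.
  - by case/negP: Y'x; rewrite -(groupJr _ (cycle_id y)) xJ groupV cycle_id.
have x2y2 : x ^+ 2 * y ^+ 2 = 1 by rewrite -expgMn.
(* Now [x ^+ 2] lies in both cycles, so equality with any of the four elements would put [x] in
   [<[y]>] or [y] in [<[x]>]; hence its square is trivial. *)
have Yx2 : x ^+ 2 \in <[y]>.
  by rewrite -(groupMr _ (mem_cycle y 2)) x2y2 group1.
split=> //; have x4 : x ^+ 4 = 1.
  apply/eqP/negPn/negP=> x4.
  have: x ^+ 2 \in [:: x; x^-1; y; y^-1] by apply: memT; rewrite ?groupX // -expgM.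
  rewrite !inE => /or4P[]/eqP x2E.
  - by case/negP: Y'x; rewrite -x2E.
  - by case/negP: Y'x; rewrite -groupV -x2E.
  - by case/negP: X'y; rewrite -x2E mem_cycle.
  - by case/negP: X'y; rewrite -groupV -x2E mem_cycle.
have: #[x] \in divisors 4 by rewrite -dvdn_divisors // order_dvdn x4.
rewrite !inE => /or3P[]/eqP // ox; rewrite -order_dvdn ox // in x2.
Qed.

Lemma two_pairs_split x y : two_pairs G x y ->
     (exists2 z, z \in G & #[z] = 6 /\ {in G :\: <[z]>, forall g, g ^+ 2 = 1})
  \/ (exists u v (A : {group gT}),
       [/\ A \subset G, <[u]> \x <[v]> = A, #[u] = 4, #[v] = 2
         & {in G :\: A, forall g, g ^+ 2 = 1}]).
Proof.
move=> Txy; have Tyx := two_pairs_sym Txy; have [Gx Gy [x2 y2] neq_xy memT] := Txy.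
have [Xy | X'y] := boolP (y \in <[x]>).
  by left; exists x => //; apply: two_pairs_cycle_order6 Txy Xy.
have [Yx | Y'x] := boolP (x \in <[y]>).
  by left; exists y => //; apply: two_pairs_cycle_order6 Tyx Yx.
have [cxy x2y2 ox] := two_pairs_commute Txy X'y Y'x.
have xy2 : (x * y) ^+ 2 = 1 by rewrite expgMn.
have X'xy : x * y \notin <[x]> by rewrite groupMl ?cycle_id.
have cXxy : <[x * y]> \subset 'C(<[x]>).
  by rewrite cycle_subG /= cent_cycle; apply/cent1P/commute_sym/commuteM.
(* The product [x * y] is an involution outside [<[x]>], and the join recovers [y], so it contains
   all four elements of order greater than 2. *)
right; exists x, (x * y), (<[x]> <*> <[x * y]>)%G; split=> //.
- by rewrite join_subG !cycle_subG Gx groupM.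
- rewrite dprodEY //; apply/trivgP/subsetP=> g /setIP[Xg].
  rewrite mem_cycle_involution // !inE => /orP[]// /eqP dg.
  by rewrite -dg Xg in X'xy.
- by apply: nt_prime_order => //; apply: contraNneq X'xy => ->; apply: group1.
have sXA : <[x]> \subset <[x]> <*> <[x * y]> := joing_subl _ _.
have Ax : x \in <[x]> <*> <[x * y]> by rewrite -cycle_subG.
have Ay : y \in <[x]> <*> <[x * y]>.
  by rewrite -(groupMl _ Ax) -cycle_subG joing_subr.
move=> g /setDP[Gg A'g]; apply/eqP; apply: contraNT A'g => /(memT g Gg).
by rewrite !inE => /or4P[]/eqP->; rewrite /= ?groupV.
Qed.

End TwoPairs.

(** * Exhibiting the two pairs inside a given subgroup *)

Section Converse.

Variables (gT : finGroupType) (G : {group gT}).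

(** Among the powers of [z], exponents 0 and 3 have trivial square; 1 and 5, and 2 and 4, form the
    two inverse pairs. *)
Lemma two_pairs_order6 (z : gT) : z \in G -> #[z] = 6 ->
  {in G :\: <[z]>, forall g, g ^+ 2 = 1} -> two_pairs G z (z ^+ 2).
Proof.
move=> Gz oz out; have z6 : z ^+ 6 = 1 by rewrite -oz expg_order.
split; rewrite ?groupX //.
- by rewrite -expgM -!order_dvdn oz.
- by apply: contra_eqN (oz) => /eqP eqz; rewrite /order eqz -orderE orderXdiv oz.
move=> g Gg g2; have /cycle_expg_lt-/(_ 6)[//|//|] : g \in <[z]>.
  by apply: contraNT g2 => Z'g; rewrite out // inE Z'g.
have zV i j : (i + j = 6)%N -> z ^+ i = (z ^+ j)^-1.
  by move=> ij; apply: (mulIg (z ^+ j)); rewrite mulVg -expgD ij.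
case=> [|[|[|[|[|[|//]]]]]] _ dg; rewrite !inE dg.
- by rewrite dg expg1n eqxx in g2.
- by rewrite expg1 eqxx.
- by rewrite eqxx !orbT.
- by rewrite dg -expgM z6 eqxx in g2.
- by rewrite (zV 4 2)%N // eqxx !orbT.
- by rewrite (zV 5 1)%N // eqxx !orbT.
Qed.

(** An element [u ^+ i * b] with [b] in [<[v]>] has the square [u ^+ (i * 2)], nontrivial exactly
    for odd [i]; this leaves [u], [u * v] and their inverses. *)
Lemma two_pairs_dprod (u v : gT) (A : {group gT}) :
    A \subset G -> <[u]> \x <[v]> = A -> #[u] = 4 -> #[v] = 2 ->
  {in G :\: A, forall g, g ^+ 2 = 1} -> two_pairs G u (u * v).
Proof.
move=> sAG /dprodP[_ defA cuv tiuv] ou ov out.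
have [sUA sVA] : <[u]> \subset A /\ <[v]> \subset A.
  by rewrite -defA mulG_subl mulG_subr.
rewrite !cycle_subG /= in sUA sVA.
have u4 : u ^+ 4 = 1 by rewrite -ou expg_order.
have v2 : v ^+ 2 = 1 by rewrite -ov expg_order.
have u2 : u ^+ 2 != 1 by rewrite -order_dvdn ou.
have cv : commute u v.
  by apply/commute_sym/cent1P; rewrite -cent_cycle (subsetP cuv) ?cycle_id.
have U'v : v \notin <[u]>.
  apply/negP=> Uv; have: v \in <[u]> :&: <[v]> by rewrite inE Uv cycle_id.
  by rewrite tiuv inE -order_eq1 ov.
have uV : u ^+ 3 = u^-1 by apply: (mulIg u); rewrite mulVg -expgSr.
have vV : v = v^-1 by apply/eqP; rewrite -[_ == _]negbK -sqrg_neq1 v2 eqxx.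
split; rewrite ?groupM ?(subsetP sAG) //.
- by rewrite expgMn // v2 mulg1.
- apply: contraNneq U'v => equv.
  by rewrite -(groupMl _ (cycle_id u)) /= equv cycle_id.
move=> g Gg g2; have: g \in <[u]> * <[v]>.
  by rewrite defA; apply: contraNT g2 => A'g; rewrite out // inE A'g.
case/mulsgP=> a b /(cycle_expg_lt _ u4)[//|i lti4 da].
rewrite mem_cycle_involution // inE mem_seq1 => b1v dg.
have {}b1v : b = 1 \/ b = v by case/orP: b1v => /eqP; [left|right].
have b2 : b ^+ 2 = 1 by case: b1v => ->; rewrite ?expg1n.
have cb : commute u b by case: b1v => -> //; apply: commute1.
have {}g2 : u ^+ (i * 2) != 1.
  move: g2; rewrite dg da expgMn ?b2 ?mulg1 ?expgM //.
  exact/commute_sym/commuteX/commute_sym.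
rewrite dg da !inE; case: i lti4 g2 {da} => [|[|[|[|//]]]] _.
- by rewrite eqxx.
- by case: b1v => ->; rewrite ?mulg1 eqxx ?orbT.
- by rewrite u4 eqxx.
- by case: b1v => ->; rewrite uV ?mulg1 ?eqxx ?orbT // cv invMg -vV eqxx !orbT.
Qed.

End Converse.

(** * Subgroups outside which every element squares to 1 *)

Section InvertedSubgroup.

Variables (gT : finGroupType) (A G : {group gT}).
Hypotheses (sAG : A \subset G) (out : {in G :\: A, forall g, g ^+ 2 = 1}).

(** Both [g] and [g * a] lie outside [A], so both square to 1; expanding [(g * a) ^+ 2 = 1] gives
    the inversion. *)
Lemma conjg_inverted : {in G :\: A & A, forall g a, a ^ g = a^-1}.
Proof.
move=> g a Dg Aa; have g2 := out Dg.
have /out : g * a \in G :\: A.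
  by case/setDP: Dg => Gg A'g; rewrite inE groupMr // A'g groupM // (subsetP sAG).
rewrite expgS expg1 => ga2; apply: (mulIg a); rewrite mulVg -ga2 conjgE.
have -> : g^-1 = g by apply: (mulIg g); rewrite mulVg -g2.
by rewrite !mulgA.
Qed.

(** The complement of [A] is the single coset of [t]: if [t^-1 * g] were also outside [A], it would
    invert [u], yet as a product of two inverting elements it would fix [u]. *)
Lemma card_inverted u t :
  u \in A -> u ^+ 2 != 1 -> t \in G :\: A -> #|G| = #|A|.*2.
Proof.
move=> Au u2 Dt; have [Gt A't] := setDP Dt.
rewrite -(cardsID A G) (setIidPr sAG) -addnn -(card_lcoset A t).
congr (_ + #|pred_of_set _|)%N; apply/setP=> g; rewrite mem_lcoset.
apply/idP/idP=> [Dg | Atg]; last first.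
  by rewrite -(mulKVg t g) inE groupMr // A't groupM // (subsetP sAG).
apply: contraNT u2 => A'tg; have [Gg _] := setDP Dg.
have Dtg : t^-1 * g \in G :\: A by rewrite inE A'tg groupM ?groupV.
have Dt' : t^-1 \in G :\: A by rewrite inE !groupV A't.
have := conjg_inverted Dtg Au; rewrite conjgM (conjg_inverted Dt' Au).
rewrite (conjg_inverted Dg) ?groupV // invgK.
by move=> uV; rewrite -[_ == _]negbK sqrg_neq1 -uV eqxx.
Qed.

End InvertedSubgroup.

(** * Dihedral groups through their presentation *)

Section Dihedral.

Variables (gT : finGroupType) (q : nat).
Hypothesis q_gt1 : 1 < q.

(** The generators satisfy the dihedral relations, and the order [q.*2] excludes a proper
    quotient. *)
Lemma isog_dihedral_generators (x t : gT) :
    #[x] = q -> t ^+ 2 = 1 -> t \notin <[x]> -> x ^ t = x^-1 ->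
  <[x]> <*> <[t]> \isog [set: 'D_q.*2] /\ #|<[x]> <*> <[t]>| = q.*2.
Proof.
move=> ox t2 X't xt.
have ot : #[t] = 2.
  by apply: nt_prime_order => //; apply: contraNneq X't => ->; apply: group1.
have nXt : <[t]> \subset 'N(<[x]>) by rewrite norms_cycle xt groupV cycle_id.
have oK : #|<[x]> <*> <[t]>| = q.*2.
  rewrite norm_joinEr // TI_cardMg; first by rewrite -!orderE ox ot muln2.
  by rewrite setIC prime_TIg -?orderE ?ot // cycle_subG.
split=> //; apply/(isoGrpP _ (Grp_dihedral q_gt1)).
rewrite card_dihedral //; split=> //.
by apply/existsP; exists (x, t); rewrite /= !xpair_eqE eqxx -ox expg_order t2 xt !eqxx.
Qed.

Lemma dihedral_cycle (G : {group gT}) : G \isog [set: 'D_q.*2] ->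
  exists2 x, x \in G & #[x] = q /\ {in G :\: <[x]>, forall g, g ^+ 2 = 1}.
Proof.
case/(isoGrpP _ (Grp_dihedral q_gt1)); rewrite card_dihedral // => oG.
case/existsP=> -[x y] /= /eqP[defG xq y2 xy].
have nXy : <[y]> \subset 'N(<[x]>) by rewrite norms_cycle xy groupV cycle_id.
have defG' : <[x]> * <[y]> = G by rewrite -norm_joinEr.
exists x; first by rewrite -defG -cycle_subG joing_subl.
have ox : #[x] <= q by apply: dvdn_leq; rewrite ?(ltnW q_gt1) // order_dvdn xq.
have oy : #[y] <= 2 by apply: dvdn_leq; rewrite // order_dvdn y2.
(* The order of [G] is [q.*2] and at most [#[x] * #[y]], with [#[y] <= 2], which forces [#[x] =
   q]. *)
split.
  apply/eqP; rewrite eqn_leq ox -leq_double -oG -muln2 /order.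
  apply: leq_trans (leq_mul (leqnn _) oy).
  by rewrite mul_cardG defG' leq_pmulr ?cardG_gt0.
move=> g /setDP[]; rewrite -defG' => /mulsgP[a b Xa].
rewrite mem_cycle_involution // !inE => /orP[]/eqP-> ->; first by rewrite mulg1 Xa.
have aJ : a ^ y = a^-1 by case/cycleP: Xa => i ->; rewrite conjXg xy expgVn.
(* Since [y] inverts [a], [(a * y) ^+ 2] collapses to [y ^+ 2]. *)
by move=> _; rewrite (expgS (a * y)) {1}(conjgC a y) aJ -mulgA mulKg.
Qed.

End Dihedral.

(** * Recognising direct products and cyclic groups *)

Lemma isog_setX_dprod (gT aT bT : finGroupType) (G : {group gT}) :
  G \isog [set: aT * bT] <->
  exists K L : {group gT}, [/\ K \x L = G, K \isog [set: aT] & L \isog [set: bT]].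
Proof.
have dpX : setX [set: aT] 1 \x setX 1 [set: bT] = [set: aT * bT].
  by rewrite setX_dprod; apply/setP=> -[a b]; rewrite !inE.
split=> [| [K [L [defG isoK isoL]]]]; last first.
  apply: (isog_dprod (L := [group of [set: aT * bT]]) defG dpX).
    exact: isog_trans isoK (isog_setX1 _ _).
  exact: isog_trans isoL (isog_set1X _ _).
(* The internal factors are the images under [f] of the two coordinate subgroups. *)
rewrite isog_sym => /isogP[f injf im_f].
have := injm_dprod (subxx _) injf dpX; rewrite im_f => defG.
exists (f @* setX [set: aT] 1)%G, (f @* setX 1 [set: bT])%G; split=> //.
  rewrite isog_sym; apply: isog_trans (isog_setX1 _ _) _.
  by apply: sub_isog; rewrite ?subsetT.
rewrite isog_sym; apply: isog_trans (isog_set1X _ _) _.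
by apply: sub_isog; rewrite ?subsetT.
Qed.

(** The bound on [n] matters: ['Z_n] always has at least two elements, even for [n] equal to 0 or
    1. *)
Lemma isog_Zp (gT : finGroupType) (G : {group gT}) n :
  1 < n -> (G \isog [set: 'Z_n]) = cyclic G && (#|G| == n).
Proof.
move=> n_gt1; have cZ : cyclic [set: 'Z_n] by apply/cyclicP; exists Zp1; apply: Zp_cycle.
by rewrite isog_sym (isog_cyclic_card _ cZ) cardsT card_ord Zp_cast.
Qed.

(** * Identifying the four groups *)

Section Classification.

Variables (gT : finGroupType) (G : {group gT}).

(** Any [t] outside [<[z]>] inverts [z], so the two generate a dihedral group of order 12, which is
    already the order of [G]. *)
Lemma isog_order6_extension (z : gT) : z \in G -> #[z] = 6 ->
    {in G :\: <[z]>, forall g, g ^+ 2 = 1} ->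
  G \isog [set: 'Z_6] \/ G \isog [set: 'D_12].
Proof.
move=> Gz oz out; have [sGZ | /subsetPn[t Gt Z't]] := boolP (G \subset <[z]>).
  have defG: G :=: <[z]> by apply/eqP; rewrite eqEsubset sGZ cycle_subG.
  by left; rewrite isog_Zp // defG cycle_cyclic -oz /=.
have sZG : <[z]> \subset G by rewrite cycle_subG.
have Dt : t \in G :\: <[z]> by apply/setDP.
have z2 : z ^+ 2 != 1 by rewrite -order_dvdn oz.
have zt := conjg_inverted sZG out Dt (cycle_id z).
have [isoK oK] := @isog_dihedral_generators gT 6 isT z t oz (out t Dt) Z't zt.
have oG := card_inverted sZG out (cycle_id z) z2 Dt.
right; suff -> : G :=: <[z]> <*> <[t]> by [].
apply/esym/eqP; rewrite eqEcard oK oG -orderE oz leqnn.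
by rewrite join_subG !cycle_subG Gz Gt.
Qed.

(** For [t] outside [A], [u] and [t] generate a dihedral group of order 8, while [v], inverted by
    [t] but equal to its inverse, is central and splits off. *)
Lemma isog_dprod_extension (u v : gT) (A : {group gT}) :
    A \subset G -> <[u]> \x <[v]> = A -> #[u] = 4 -> #[v] = 2 ->
    {in G :\: A, forall g, g ^+ 2 = 1} ->
  G \isog [set: 'Z_4 * 'Z_2] \/ G \isog [set: 'D_8 * 'Z_2].
Proof.
move=> sAG defA ou ov out.
have isoZ w n : 1 < n -> #[w] = n -> <[w : gT]> \isog [set: 'Z_n].
  by move=> n_gt1 ow; rewrite isog_Zp // cycle_cyclic -ow /=.
have [sGA | /subsetPn[t Gt A't]] := boolP (G \subset A).
  have defG: G :=: A by apply/eqP; rewrite eqEsubset sGA.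
  left; apply/isog_setX_dprod; exists <[u]>%G, <[v]>%G.
  by rewrite /= defG !isoZ.
have [_ defUV cUV tiUV] := dprodP defA.
have Dt : t \in G :\: A by apply/setDP.
have [sUA sVA] : <[u]> \subset A /\ <[v]> \subset A.
  by rewrite -defUV mulG_subl mulG_subr.
have Au : u \in A by rewrite -cycle_subG.
have Av : v \in A by rewrite -cycle_subG.
have U't : t \notin <[u]> by apply: contra A't; apply: subsetP.
have u2 : u ^+ 2 != 1 by rewrite -order_dvdn ou.
have v2 : v ^+ 2 = 1 by rewrite -ov expg_order.
have ut := conjg_inverted sAG out Dt Au.
have vt := conjg_inverted sAG out Dt Av.
have [isoK oK] := @isog_dihedral_generators gT 4 isT u t ou (out t Dt) U't ut.
have oG := card_inverted sAG out Au u2 Dt.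
have sKG : <[u]> <*> <[t]> \subset G.
  by rewrite join_subG !cycle_subG (subsetP sAG) ?Gt.
have cKV : <[v]> \subset 'C(<[u]> <*> <[t]>).
  rewrite centY subsetI cUV cycle_subG /= cent_cycle; apply/cent1P.
  rewrite /commute conjgC vt; congr (_ * _).
  by apply: (mulIg v); rewrite mulVg -v2.
(* Elements of the join are [a] or [a * t] with [a] in [<[u]>]: the first kind meets [<[v]>]
   trivially, the second lies outside [A]. *)
have K'v : v \notin <[u]> <*> <[t]>.
  rewrite norm_joinEr ?norms_cycle ?ut ?groupV ?cycle_id //.
  apply/negP=> /mulsgP[a b Ua]; rewrite mem_cycle_involution ?out // !inE.
  case/orP=> /eqP-> dv; last first.
    by case/negP: A't; rewrite -(groupMl _ (subsetP sUA a Ua)) -dv.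
  have: v \in <[u]> :&: <[v]> by rewrite inE cycle_id dv mulg1 Ua.
  by rewrite tiUV inE -order_eq1 ov.
have tiKV : (<[u]> <*> <[t]>) :&: <[v]> = 1.
  by rewrite setIC prime_TIg -?orderE ?ov // cycle_subG.
right; apply/isog_setX_dprod.
exists (<[u]> <*> <[t]>)%G, <[v]>%G; split; rewrite ?isoZ //.
rewrite dprodE //; apply/eqP; rewrite eqEcard mul_subG ?cycle_subG ?(subsetP sAG) //=.
rewrite TI_cardMg // oK oG -defUV TI_cardMg // -!orderE ou ov //.
Qed.

(** The subgroup [A] is the rotation subgroup of [K] times [L]; an element [k * l] outside it has
    [k] a reflection, and [l] is central of exponent 2. *)
Lemma two_pairs_dprod_dihedral (K L : {group gT}) :
    K \x L = G -> K \isog [set: 'D_8] -> L \isog [set: 'Z_2] ->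
  exists x y, two_pairs G x y.
Proof.
move=> defG isoK; rewrite isog_Zp // => /andP[/cyclicP[v defL] /eqP oL].
have [u Ku [ou out]] := dihedral_cycle (q := 4) isT isoK.
have [_ defKL cKL tiKL] := dprodP defG.
have [sKG sLG] : K \subset G /\ L \subset G.
  by rewrite -defKL mulG_subl mulG_subr.
have sUK : <[u]> \subset K by rewrite cycle_subG.
have sVG : <[v]> \subset G by rewrite -defL.
have defA : <[u]> \x <[v]> = <[u]> <*> <[v]>.
  by rewrite -defL dprodEY ?(subset_trans cKL) ?centS //; apply/trivgP; rewrite -tiKL setSI.
have v2 : v ^+ 2 = 1 by rewrite -oL defL -orderE expg_order.
exists u, (u * v).
apply: (two_pairs_dprod (A := <[u]> <*> <[v]>)%G) => //.
* by rewrite join_subG sVG (subset_trans sUK).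
* by rewrite orderE -defL.
move=> g /setDP[]; rewrite -defKL => /mulsgP[k l Kk Ll ->] A'kl.
have l2 : l ^+ 2 = 1 by rewrite -oL; apply/expg_cardG.
have ckl : commute k l by apply/commute_sym/(centP (subsetP cKL l Ll)).
rewrite expgMn // l2 mulg1 out // inE Kk andbT.
apply: contra A'kl => Uk; rewrite groupM //.
  by rewrite (subsetP _ k Uk) ?joing_subl.
by rewrite (subsetP _ l Ll) // defL joing_subr.
Qed.

End Classification.

(* 'Z_n carries its additive (cyclic of order n) group structure. *)
Theorem theorem2 (gT : finGroupType) (G : {group gT}) :
  (#|cyclic_subgroups G| + 2)%N = #|G| <->
  [\/ G \isog [set: 'Z_4 * 'Z_2],
      G \isog [set: 'D_8 * 'Z_2],
      G \isog [set: 'Z_6]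
    | G \isog 'D_12].
Proof.
split=> [/two_pairs_of_card[x [y /two_pairs_split]] | isoG].
- case=> [[z Gz [oz out]] | [u [v [A [sAG defA ou ov out]]]]].
    by have [|] := isog_order6_extension Gz oz out; [constructor 3|constructor 4].
  by have [|] := isog_dprod_extension sAG defA ou ov out; [constructor 1|constructor 2].
- suff [x [y /cycle_card_two_pairs]] : exists x y, two_pairs G x y by [].
  case: isoG => [/isog_setX_dprod[K [L [defG]]] | /isog_setX_dprod[K [L [defG isoK isoL]]]
                | |].
  + rewrite !isog_Zp // => /andP[/cyclicP[u defK] /eqP oK] /andP[/cyclicP[v defL] /eqP oL].
    (* Taking [A] to be [G] leaves no element outside to check. *)
    exists u, (u * v); apply: (two_pairs_dprod (A := G)); rewrite -?defK -?defL //.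
    * by rewrite orderE -defK.
    * by rewrite orderE -defL.
    * by move=> g; rewrite setDv inE.
  + exact: two_pairs_dprod_dihedral defG isoK isoL.
  + rewrite isog_Zp // => /andP[/cyclicP[z defG] /eqP oG].
    exists z, (z ^+ 2); apply: two_pairs_order6; rewrite -?defG ?orderE -?defG //.
      by rewrite defG cycle_id.
    by move=> g; rewrite setDv inE.
  + case/(dihedral_cycle (q := 6) isT)=> z Gz [oz out].
    by exists z, (z ^+ 2); apply: two_pairs_order6.
Qed.
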